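(* Let $(K,\xi)$ be a descending divisibly weighted simplicial complex and $R$ a commutative ring with unit. For any cohomology classes $[\hat{\phi}]\in\widehat{H}^p(K,\hat{\delta}^{\xi};R)$ and $[\hat{\psi}]\in\widehat{H}^q(K,\hat{\delta}^{\xi};R)$, $$[\hat{\phi}]\,\hat{\Cup}\,[\hat{\psi}]=(-1)^{pq}\,[\hat{\psi}]\,\hat{\Cup}\,[\hat{\phi}].$$
   Context: Simplicial complexes are finite. A descending weight on a simplicial complex $K$ is a function $\xi$ from the simplices of $K$ to the positive integers with $\xi(\sigma)\mid\xi(\sigma')$ whenever $\sigma'$ is a face of $\sigma$; it is divisible if the vertices of every simplex $\sigma$ can be ordered $v_0,\dots,v_k$ with $\xi(\sigma)=\xi(v_0)\mid\xi(v_1)\mid\cdots\mid\xi(v_k)$. Then $(K,\xi)$ is called a descending divisibly weighted simplicial complex. An ordered $n$-simplex of $K$ is an $(n+1)$-tuple $\langle v_0,\dots,v_n\rangle$ of (not necessarily distinct) vertices of a simplex of $K$; $\widehat{C}_n(K)$ is the free abelian group on the ordered $n$-simplices. The weight $\xi(\langle v_0,\dots,v_n\rangle)$ is the weight of the simplex spanned by the distinct vertices among $v_0,\dots,v_n$. The boundary map is $$\hat{\partial}^{\xi}\langle v_0,\dots,v_n\rangle=\sum_{i=0}^n(-1)^i\frac{\xi(\langle v_0,\dots,\widehat{v}_i,\dots,v_n\rangle)}{\xi(\langle v_0,\dots,v_n\rangle)}\langle v_0,\dots,\widehat{v}_i,\dots,v_n\rangle .$$ $\widehat{C}^*(K;R)=\mathrm{Hom}(\widehat{C}_*(K),R)$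 with coboundary $\hat{\delta}^{\xi}\hat{\phi}=\hat{\phi}\circ\hat{\partial}^{\xi}$, and $\widehat{H}^*(K,\hat{\delta}^{\xi};R)$ is its cohomology. For $\hat{\phi}\in\widehat{C}^p(K;R)$, $\hat{\psi}\in\widehat{C}^q(K;R)$ the weighted cup product $\hat{\phi}\,\hat{\Cup}\,\hat{\psi}\in\widehat{C}^{p+q}(K;R)$ is $$(\hat{\phi}\,\hat{\Cup}\,\hat{\psi})(\langle v_0,\dots,v_{p+q}\rangle)=\frac{\xi(\langle v_0,\dots,v_p\rangle)\,\xi(\langle v_p,\dots,v_{p+q}\rangle)}{\xi(\langle v_0,\dots,v_{p+q}\rangle)}\,\hat{\phi}(\langle v_0,\dots,v_p\rangle)\cdot\hat{\psi}(\langle v_p,\dots,v_{p+q}\rangle)$$ (the coefficient is an integer). It satisfies $\hat{\delta}^{\xi}(\hat{\phi}\,\hat{\Cup}\,\hat{\psi})=\hat{\delta}^{\xi}\hat{\phi}\,\hat{\Cup}\,\hat{\psi}+(-1)^p\hat{\phi}\,\hat{\Cup}\,\hat{\delta}^{\xi}\hat{\psi}$ and so induces a product, also denoted $\hat{\Cup}$, on $\widehat{H}^*(K,\hat{\delta}^{\xi};R)$. *)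

(* Defs.v *)
(* boolp is used for the eqType and choiceType of homomorphisms and to decide
   membership in the group of coboundaries. *)
From HB Require Import structures.
From mathcomp Require Import all_boot all_order all_algebra.
From mathcomp Require Import ring_quotient boolp freeg zify.

Set Implicit Arguments.
Unset Strict Implicit.
Unset Printing Implicit Defensive.

Import GRing.Theory.
Local Open Scope ring_scope.

Section Hom.
Variables U V : zmodType.

Definition Hom := {additive U -> V}.

HB.instance Definition _ := gen_eqMixin Hom.
HB.instance Definition _ := gen_choiceMixin Hom.

Identity Coercion Hom_additive : Hom >-> GRing.Additive.type.

Lemma HomP (f g : Hom) : (forall x, f x = g x) <-> f = g.
Proof.
split=> [fg|-> //].
case: f g fg => f [[fA]] [g [[gA]]] /= /funext fg.
by case: _ / fg gA => gA; rewrite (Prop_irrelevance fA gA).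
Qed.

Definition Hom_zero : Hom := (\0 : U -> V).
Definition Hom_opp (f : Hom) : Hom := \- f.
Definition Hom_add (f g : Hom) : Hom := f \+ g.

Fact Hom_addA : associative Hom_add.
Proof. by move=> f g h; apply/HomP=> x /=; rewrite addrA. Qed.
Fact Hom_addC : commutative Hom_add.
Proof. by move=> f g; apply/HomP=> x /=; rewrite addrC. Qed.
Fact Hom_add0 : left_id Hom_zero Hom_add.
Proof. by move=> f; apply/HomP=> x /=; rewrite add0r. Qed.
Fact Hom_addN : left_inverse Hom_zero Hom_opp Hom_add.
Proof. by move=> f; apply/HomP=> x /=; rewrite addNr. Qed.

HB.instance Definition _ :=
  GRing.isZmodule.Build Hom Hom_addA Hom_addC Hom_add0 Hom_addN.
End Hom.

Record simplicial_complex (V : finType) := SimplicialComplex {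
  simplices : {set {set V}};
  simplex_neq0 : forall s, s \in simplices -> s != set0;
  simplex_face : forall s t : {set V},
    s \in simplices -> t \subset s -> t != set0 -> t \in simplices }.

(* The values of [weight] outside [simplices K] are irrelevant. *)
Record descending_weight (V : finType) (K : simplicial_complex V) :=
  DescendingWeight {
    weight :> {set V} -> nat;
    weight_gt0 : forall s, s \in simplices K -> (0 < weight s)%N;
    weight_desc : forall s t : {set V}, s \in simplices K -> t \in simplices K ->
      t \subset s -> (weight s %| weight t)%N }.

Definition divisible (V : finType) (K : simplicial_complex V)
    (xi : descending_weight K) : Prop :=
  forall s, s \in simplices K -> exists (v0 : V) (vs : seq V),
    [/\ uniq (v0 :: vs), [set v in v0 :: vs] = s, xi s = xi [set v0] &
        path (fun v w => (xi [set v] %| xi [set w])%N) v0 vs].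

Section OrderedSimplices.
Variables (V : finType) (K : simplicial_complex V).

Definition osimplex (n : nat) :=
  {v : n.+1.-tuple V | [set x in v] \in simplices K}.

HB.instance Definition _ n := Finite.on (osimplex n).

Definition span n (s : osimplex n) : {set V} := [set x in val s].

Fact reindex_proof m n (f : 'I_m.+1 -> 'I_n.+1) (s : osimplex n) :
  [set x in [tuple tnth (val s) (f j) | j < m.+1]] \in simplices K.
Proof.
apply: simplex_face (valP s) _ _.
  apply/subsetP=> x; rewrite !inE => /tnthP[j ->].
  by rewrite tnth_mktuple mem_tnth.
apply/set0Pn; exists (tnth (val s) (f ord0)); rewrite inE.
by apply/tnthP; exists ord0; rewrite tnth_mktuple.
Qed.

Definition reindex m n (f : 'I_m.+1 -> 'I_n.+1) (s : osimplex n) : osimplex m :=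
  exist _ [tuple tnth (val s) (f j) | j < m.+1] (reindex_proof f s).

Definition face n (i : 'I_n.+2) : osimplex n.+1 -> osimplex n :=
  reindex (fintype.lift i).

(* <v_0, ..., v_p> and <v_p, ..., v_(p+q)>, meant for n = p + q. *)
Definition front p n : osimplex n -> osimplex p :=
  reindex (fun j : 'I_p.+1 => inord j).
Definition back p q n : osimplex n -> osimplex q :=
  reindex (fun j : 'I_q.+1 => inord (p + j)).

Definition chain (n : nat) := {freeg (osimplex n) / int}.

HB.instance Definition _ n := GRing.Lmodule.on (chain n).

(* The homomorphism prescribed on the basis of ordered simplices; [zmodule M]
   is M with its canonical structure of int-module. *)
Definition extend n (M : zmodType) (f : osimplex n -> M) : chain n -> M :=
  @fglift int (zmodule M) (osimplex n) f.

Fact extend_additive n (M : zmodType) (f : osimplex n -> M) :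
  zmod_morphism (extend f).
Proof. exact: (@lift_is_additive int (osimplex n) (zmodule M) f). Qed.

HB.instance Definition _ n (M : zmodType) (f : osimplex n -> M) :=
  GRing.isZmodMorphism.Build (chain n) M (extend f) (extend_additive f).

End OrderedSimplices.

Arguments front {V K} p {n} s.
Arguments back {V K} p q {n} s.

Section Cohomology.
Variables (V : finType) (K : simplicial_complex V) (xi : descending_weight K).
Variable R : comPzRingType.

Definition oweight n (s : osimplex K n) : nat := xi (span s).

(* [%/] is exact below since the weight of an ordered simplex divides that of
   its faces, see [oweight_reindex]. *)
Definition boundary n : chain K n.+1 -> chain K n :=
  extend (fun s : osimplex K n.+1 =>
    \sum_(i < n.+2)
      << (-1) ^+ i * (oweight (face i s) %/ oweight s)%N%:Z *g face i s >>).

HB.instance Definition _ n := GRing.Additive.on (@boundary n).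

Definition cochain (n : nat) := Hom (chain K n) R.

HB.instance Definition _ n := GRing.Zmodule.on (cochain n).

Definition coboundary n (phi : cochain n) : cochain n.+1 :=
  phi \o @boundary n.

Definition cup p q n (e : (p + q = n)%N) (phi : cochain p) (psi : cochain q) :
    cochain n :=
  extend (fun s : osimplex K n =>
    (oweight (front p s) * oweight (back p q s) %/ oweight s)%N%:R
      * (phi << front p s >> * psi << back p q s >>)).

Lemma oweight_gt0 n (s : osimplex K n) : (0 < oweight s)%N.
Proof. exact: weight_gt0 (valP s). Qed.

Lemma oweight_reindex m n (f : 'I_m.+1 -> 'I_n.+1) (s : osimplex K n) :
  (oweight s %| oweight (reindex f s))%N.
Proof.
apply: weight_desc (valP s) (valP (reindex f s)) _.
apply/subsetP=> x; rewrite !inE => /tnthP[j ->].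
by rewrite tnth_mktuple mem_tnth.
Qed.

Lemma extendU n (M : zmodType) (f : osimplex K n -> M) k s :
  extend f << k *g s >> = f s *~ k.
Proof. by rewrite /extend liftU. Qed.

Lemma cochainU n (phi : cochain n) k s : phi << k *g s >> = phi << s >> *~ k.
Proof. by rewrite -raddfMz freeg_mulz intz. Qed.

Lemma cochainP n (phi psi : cochain n) :
  (forall s, phi << s >> = psi << s >>) -> phi = psi.
Proof.
move=> eq_s; apply/HomP=> c; rewrite -(freeg_sumE c) !raddf_sum.
by apply: eq_bigr => s _; rewrite [LHS]cochainU [RHS]cochainU eq_s.
Qed.

Lemma coboundaryE n (phi : cochain n) s : coboundary phi << s >> =
  \sum_(i < n.+2) (-1) ^+ i * (oweight (face i s) %/ oweight s)%N%:R
    * phi << face i s >>.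
Proof.
rewrite /coboundary /= /boundary extendU mulr1z raddf_sum.
apply: eq_bigr => i _; rewrite /= cochainU -mulrzl.
by rewrite intrM rmorphXn rmorphN1.
Qed.

Lemma cupE p q n (e : (p + q = n)%N) (phi : cochain p) (psi : cochain q) s :
  cup e phi psi << s >> =
  (oweight (front p s) * oweight (back p q s) %/ oweight s)%N%:R
    * (phi << front p s >> * psi << back p q s >>).
Proof. by rewrite /cup /= extendU mulr1z. Qed.

Lemma reindex_comp m n k (f : 'I_m.+1 -> 'I_n.+1) (g : 'I_n.+1 -> 'I_k.+1)
    (s : osimplex K k) : reindex f (reindex g s) = reindex (g \o f) s.
Proof. by apply/val_inj/eq_from_tnth=> j; rewrite !tnth_mktuple. Qed.

Lemma eq_reindex m n (f g : 'I_m.+1 -> 'I_n.+1) (s : osimplex K n) :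
  (forall j, f j = g j :> nat) -> reindex f s = reindex g s.
Proof.
move=> fg; apply/val_inj/eq_from_tnth=> j; rewrite !tnth_mktuple.
by congr tnth; apply/val_inj/fg.
Qed.

Lemma divn_chain a b c : (0 < b)%N -> (a %| b)%N -> (b %| c)%N ->
  ((b %/ a) * (c %/ b) = c %/ a)%N.
Proof.
by move=> b0 ab /dvdnP[k ->]; rewrite mulnK // mulnC muln_divA.
Qed.

Lemma divn_chainM a b c d : (0 < b)%N -> (a %| b)%N -> (b %| c)%N ->
  ((b * d %/ a) * (c %/ b) = c * d %/ a)%N.
Proof.
move=> b0 ab bc; have ac := dvdn_trans ab bc.
by rewrite -!divn_mulAC // mulnAC divn_chain.
Qed.

Lemma Hom_evalMz (U W : zmodType) (f : Hom U W) (z : int) x :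
  (f *~ z) x = f x *~ z.
Proof.
have Mn m : (f *+ m) x = f x *+ m.
  by elim: m => [|m IH]; rewrite ?mulr0n // !mulrS -IH.
case: z => m; first exact: Mn.
by rewrite NegzE !mulrNz -[LHS]/(- (f *+ _) x) Mn.
Qed.

Lemma coboundary_cup p q n (e : (p + q = n)%N) (e1 : (p.+1 + q = n.+1)%N)
    (e2 : (p + q.+1 = n.+1)%N) (phi : cochain p) (psi : cochain q) :
  coboundary (cup e phi psi) =
  cup e1 (coboundary phi) psi + cup e2 phi (coboundary psi) *~ (-1) ^+ p.
Proof.
apply: cochainP => s.
rewrite -[RHS]/(cup e1 (coboundary phi) psi << s >>
  + (cup e2 phi (coboundary psi) *~ (-1) ^+ p) << s >>) Hom_evalMz.
rewrite coboundaryE !cupE !coboundaryE.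
pose G (a : osimplex K p) (b : osimplex K q) : R :=
  (oweight a * oweight b %/ oweight s)%N%:R * (phi << a >> * psi << b >>).
transitivity (\sum_(0 <= i < n.+2)
  (-1) ^+ i * G (front p (face (inord i) s)) (back p q (face (inord i) s))).
  rewrite big_mkord; apply: eq_bigr => i _; rewrite inord_val cupE.
  rewrite -!mulrA; congr (_ * _); rewrite [LHS]mulrA;
  rewrite -natrM divn_chain //.
  - exact: oweight_gt0.
  - exact: oweight_reindex.
  - exact/dvdn_mulr/oweight_reindex.
set F1 := front p.+1 s; set B1 := back p.+1 q s.
set F2 := front p s; set B2 := back p q.+1 s.
have -> : (oweight F1 * oweight B1 %/ oweight s)%N%:R *
   ((\sum_(i < p.+2) (-1) ^+ i * (oweight (face i F1) %/ oweight F1)%N%:R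
       * phi << face i F1 >>) * psi << B1 >>) =
   \sum_(0 <= i < p.+2) (-1) ^+ i * G (face (inord i) F1) B1.
  rewrite big_mkord mulr_suml mulr_sumr; apply: eq_bigr => i _.
  rewrite inord_val -!mulrA mulrCA; congr (_ * _); rewrite [LHS]mulrA -natrM.
  rewrite divn_chainM //; [exact: oweight_gt0 | exact: oweight_reindex..].
have -> : (oweight F2 * oweight B2 %/ oweight s)%N%:R * (phi << F2 >> *
   \sum_(i < q.+2) (-1) ^+ i * (oweight (face i B2) %/ oweight B2)%N%:R
       * psi << face i B2 >>) =
   \sum_(0 <= i < q.+2) (-1) ^+ i * G F2 (face (inord i) B2).
  rewrite big_mkord mulr_sumr mulr_sumr; apply: eq_bigr => i _.
  rewrite inord_val -!mulrA [X in _ * X = _]mulrCA [LHS]mulrCA; congr (_ * _).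
  rewrite [X in _ * X = _]mulrCA [LHS]mulrA -natrM.
  rewrite [(oweight F2 * _)%N]mulnC divn_chainM;
    [by rewrite mulnC | exact: oweight_gt0 | exact: oweight_reindex..].
rewrite -mulrzl rmorphXn rmorphN1 mulr_sumr.
have -> : n.+2 = (p.+1 + q.+1)%N by lia.
rewrite (@big_cat_nat _ _ _ p.+1) ?leq_addr //=.
rewrite [X in _ = X + _]big_nat_recr //= [X in _ = _ + X]big_nat_recl //=.
have -> : G F2 (face (inord 0) B2) = G (face (inord p.+1) F1) B1.
  congr G; rewrite /F1 /F2 /B1 /B2 /face /front /back !reindex_comp;
  apply: eq_reindex => j /=; rewrite /bump !inordK; have := ltn_ord j; lia.
rewrite -{2}[p.+1]add0n big_addn addKn.
rewrite expr0 mul1r exprS mulN1r mulNr -addrA [X in _ = _ + X]addrA addNr add0r.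
congr (_ + _); rewrite big_nat [RHS]big_nat; apply: eq_bigr => i /andP[_ ltip].
  congr (_ * _); rewrite /F1 /F2 /B1 /B2 /face /front /back !reindex_comp.
  by congr G; apply: eq_reindex => j /=; rewrite /bump !inordK; have := ltn_ord j; lia.
rewrite [RHS]mulrA -exprD addnS -addSn addnC; congr (_ * _).
rewrite /F1 /F2 /B1 /B2 /face /front /back !reindex_comp.
by congr G; apply: eq_reindex => j /=; rewrite /bump !inordK; have := ltn_ord j; lia.
Qed.

Fact coboundary_additive n : zmod_morphism (@coboundary n).
Proof. by move=> f g; apply/HomP=> c. Qed.

HB.instance Definition _ n :=
  GRing.isZmodMorphism.Build (cochain n) (cochain n.+1)
    (@coboundary n) (@coboundary_additive n).

Definition cocycles n : {pred cochain n} := [pred phi | coboundary phi == 0].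

Fact cocycles_zmod_closed n : zmod_closed (@cocycles n).
Proof.
split=> [|f g]; rewrite !inE ?raddf0 // => /eqP f0 /eqP g0.
by rewrite raddfB /= f0 g0 subrr.
Qed.

HB.instance Definition _ n :=
  GRing.isZmodClosed.Build (cochain n) (@cocycles n) (@cocycles_zmod_closed n).

Record cocycle n := Cocycle {
  cocycle_val :> cochain n;
  cocycleP : cocycle_val \in @cocycles n }.

HB.instance Definition _ n := [isSub for @cocycle_val n].
HB.instance Definition _ n := [Choice of cocycle n by <:].
HB.instance Definition _ n := [SubChoice_isSubZmodule of cocycle n by <:].

Definition is_coboundary n : cochain n -> Prop :=
  match n with
  | 0 => fun phi => phi = 0
  | m.+1 => fun phi => exists psi : cochain m, phi = coboundary psi
  end.

Definition coboundaries n : {pred cocycle n} :=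
  [pred phi : cocycle n | `[< is_coboundary phi >] ].

Lemma is_coboundary0 n : is_coboundary (0 : cochain n).
Proof. by case: n => [//|n]; exists 0; rewrite raddf0. Qed.

Lemma is_coboundaryB n (f g : cochain n) :
  is_coboundary f -> is_coboundary g -> is_coboundary (f - g).
Proof.
case: n f g => [|n] f g /= => [-> ->|[a ->] [b ->]]; first by rewrite subrr.
by exists (a - b); rewrite raddfB.
Qed.

Fact coboundaries_zmod_closed n : zmod_closed (@coboundaries n).
Proof.
split=> [|f g]; rewrite !inE; first exact/asboolP/is_coboundary0.
by move=> /asboolP Bf /asboolP Bg; apply/asboolP/is_coboundaryB.
Qed.

HB.instance Definition _ n :=
  GRing.isZmodClosed.Build (cocycle n) (@coboundaries n)
    (@coboundaries_zmod_closed n).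

Definition cohomology n := Quotient.quot (@coboundaries n).

HB.instance Definition _ n := GRing.Zmodule.on (cohomology n).

Definition cohomology_class n (phi : cocycle n) : cohomology n :=
  (\pi_(cohomology n) phi)%qT.

Lemma cohomology_classP n (f g : cocycle n) :
  cohomology_class f = cohomology_class g <-> is_coboundary (f - g : cochain n).
Proof.
split=> [/eqP|Bfg]; last apply/eqP; rewrite /cohomology_class piE.
  by move/asboolP.
exact/asboolP.
Qed.

Lemma cupBl p q n (e : (p + q = n)%N) (f g : cochain p) (h : cochain q) :
  cup e (f - g) h = cup e f h - cup e g h.
Proof.
apply: cochainP => s; rewrite -[RHS]/(cup e f h << s >> - cup e g h << s >>).
by rewrite !cupE -mulrBr -mulrBl.
Qed.

Lemma cupBr p q n (e : (p + q = n)%N) (f : cochain p) (g h : cochain q) :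
  cup e f (g - h) = cup e f g - cup e f h.
Proof.
apply: cochainP => s; rewrite -[RHS]/(cup e f g << s >> - cup e f h << s >>).
by rewrite !cupE -mulrBr -mulrBr.
Qed.

Lemma cup0l p q n (e : (p + q = n)%N) (h : cochain q) :
  cup e (0 : cochain p) h = 0.
Proof. by rewrite -(subrr 0) cupBl subrr. Qed.

Lemma cup0r p q n (e : (p + q = n)%N) (f : cochain p) :
  cup e f (0 : cochain q) = 0.
Proof. by rewrite -(subrr 0) cupBr subrr. Qed.

Fact cup_cocycle_proof p q n (e : (p + q = n)%N) (phi : cocycle p)
    (psi : cocycle q) : cup e phi psi \in @cocycles n.
Proof.
have e1 : (p.+1 + q = n.+1)%N by rewrite addSn e.
have e2 : (p + q.+1 = n.+1)%N by rewrite addnS e.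
have /eqP d1 := cocycleP phi; have /eqP d2 := cocycleP psi.
by rewrite inE (coboundary_cup e e1 e2) d1 d2 cup0l cup0r add0r mul0rz.
Qed.

Definition cup_cocycle p q n (e : (p + q = n)%N) (phi : cocycle p)
  (psi : cocycle q) : cocycle n := Cocycle (cup_cocycle_proof e phi psi).

(* Independent of the chosen representatives by [cup_classE]. *)
Definition cup_class p q n (e : (p + q = n)%N) (x : cohomology p)
    (y : cohomology q) : cohomology n :=
  cohomology_class (cup_cocycle e (repr x) (repr y)).

Lemma is_coboundary_cupl p q n (e : (p + q = n)%N) (phi : cochain p)
    (psi : cocycle q) : is_coboundary phi -> is_coboundary (cup e phi psi).
Proof.
have /eqP dpsi := cocycleP psi.
case: p e phi => [|p] e phi /= => [->|[a ->]].
  by rewrite cup0l; apply: is_coboundary0.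
case: n e => [//|n] e /=; have e0 : (p + q = n)%N by case: e.
have e2 : (p + q.+1 = n.+1)%N by rewrite addnS e0.
exists (cup e0 a psi).
by rewrite (coboundary_cup e0 e e2) dpsi cup0r mul0rz addr0.
Qed.

Lemma is_coboundary_cupr p q n (e : (p + q = n)%N) (phi : cocycle p)
    (psi : cochain q) : is_coboundary psi -> is_coboundary (cup e phi psi).
Proof.
have /eqP dphi := cocycleP phi.
case: q e psi => [|q] e psi /= => [->|[b ->]].
  by rewrite cup0r; apply: is_coboundary0.
case: n e => [|n] e /=; first by have := e; rewrite addnS.
have e0 : (p + q = n)%N by have := e; rewrite addnS => -[].
have e1 : (p.+1 + q = n.+1)%N by rewrite addSn e0.
exists (cup e0 phi b *~ (-1) ^+ p).
rewrite raddfMz /= (coboundary_cup e0 e1 e) dphi cup0l add0r.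
by rewrite -mulrzA -expr2 sqrr_sign mulr1z.
Qed.

Lemma cup_classE p q n (e : (p + q = n)%N) (phi : cocycle p) (psi : cocycle q) :
  cup_class e (cohomology_class phi) (cohomology_class psi) =
  cohomology_class (cup_cocycle e phi psi).
Proof.
rewrite /cup_class; set f := repr _; set g := repr _.
have Bf : is_coboundary (f - phi : cochain p).
  by apply/cohomology_classP; rewrite /cohomology_class reprK.
have Bg : is_coboundary (g - psi : cochain q).
  by apply/cohomology_classP; rewrite /cohomology_class reprK.
apply/cohomology_classP => /=.
have -> : cup e f g - cup e phi psi = cup e (f - phi : cochain p) g
    - cup e phi (psi - g : cochain q).
  by rewrite cupBl cupBr opprB addrA addrNK.
apply: is_coboundaryB; first exact: is_coboundary_cupl.
by apply: is_coboundary_cupr; rewrite -opprB -[- _]add0r; apply: is_coboundaryB;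
  first exact: is_coboundary0.
Qed.

End Cohomology.

(* Main.v *)
(* For an ordered simplex <v_0, ..., v_n> let rho <v_0, ..., v_n> be
   (-1)^(n(n+1)/2) <v_n, ..., v_0>. Pulling back along rho turns a cup product
   into (-1)^(pq) times the cup product in the opposite order, so it suffices
   that this pullback induces the identity in cohomology. The prism operator
   <v_0, ..., v_n> |-> sum_i +- <v_0, ..., v_i, v_n, ..., v_i> is a homotopy
   from the identity to rho. The simplices occurring in it all span the same
   simplex as <v_0, ..., v_n>, hence have the same weight, so that the
   unweighted computation carries over. *)
Require Import Defs.
From HB Require Import structures.
From mathcomp Require Import all_boot all_order all_algebra.
From mathcomp Require Import freeg zify.

Set Implicit Arguments.
Unset Strict Implicit.
Unset Printing Implicit Defensive.

Import Defs GRing.Theory.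
Local Open Scope ring_scope.

(* [B i k] stands for the [k]-th face of the [i]-th prism simplex and [A i j]
   for the [i]-th prism simplex of the [j]-th face. *)
Lemma prism_sum (M : zmodType) (n : nat) (A B : nat -> nat -> M)
    (Y : nat -> M) :
    (forall i k, (k < i.+1)%N -> (i < n)%N -> B i.+1 k = - A i k) ->
    (forall i k, (i < k)%N -> (k <= n)%N -> B i k = - A i (n + i.+1 - k)%N) ->
    (forall i, (i <= n)%N -> B i i + B i n.+1 = Y i - Y i.+1) ->
  \sum_(0 <= i < n.+1) \sum_(0 <= k < n.+2) B i k =
  Y 0%N - Y n.+1 - \sum_(0 <= i < n) \sum_(0 <= j < n.+1) A i j.
Proof.
move=> BAl BAr BY.
(* For each i the faces split into k < i, i < k <= n and the pair k = i, k = n+1; these pairs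
   telescope through [Y]. *)
have -> : \sum_(0 <= i < n.+1) \sum_(0 <= k < n.+2) B i k =
    \sum_(0 <= i < n.+1) \sum_(0 <= k < i) B i k +
    \sum_(0 <= i < n.+1) \sum_(i.+1 <= k < n.+1) B i k +
    \sum_(0 <= i < n.+1) (Y i - Y i.+1).
  rewrite -!big_split /= big_nat [RHS]big_nat.
  apply: eq_bigr => i /andP[_ lein].
  rewrite -(BY _ lein) [LHS](@big_cat_nat _ _ _ i) ?leqW ?(ltnW lein) //=.
  rewrite -!addrA; congr (_ + _); rewrite big_nat_recr ?leqW //=.
  by rewrite big_ltn // -addrA addrCA.
have -> : \sum_(0 <= i < n.+1) (Y i - Y i.+1) = Y 0%N - Y n.+1.
  rewrite -[RHS]opprB -telescope_sumr // -sumrN.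
  by apply: eq_bigr => i _; rewrite opprB.
rewrite addrC; congr (_ + _).
have -> : \sum_(0 <= i < n.+1) \sum_(0 <= k < i) B i k =
    - \sum_(0 <= i < n) \sum_(0 <= j < i.+1) A i j.
  rewrite big_nat_recl // [X in X + _]big_geq // add0r -sumrN.
  rewrite big_nat [RHS]big_nat.
  apply: eq_bigr => i /andP[_ ltin]; rewrite -sumrN big_nat [RHS]big_nat.
  by apply: eq_bigr => k /andP[_ ltki]; apply: BAl.
have -> : \sum_(0 <= i < n.+1) \sum_(i.+1 <= k < n.+1) B i k =
    - \sum_(0 <= i < n) \sum_(i.+1 <= j < n.+1) A i j.
  rewrite big_nat_recr //= [X in _ + X]big_geq // addr0 -sumrN.
  apply: eq_bigr => i _.
  (* The index j = n+1+i-k runs down through i+1, ..., n as k runs up. *)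
  rewrite big_nat_rev -sumrN big_nat [RHS]big_nat /=.
  apply: eq_bigr => k /andP[ltik lekn]; rewrite BAr; [|lia..].
  by congr (- A _ _); lia.
rewrite -opprD -big_split /= big_nat [in RHS]big_nat; congr (- _).
apply: eq_bigr => i /andP[_ ltin].
by rewrite [RHS](@big_cat_nat _ _ _ i.+1) //= ltnS ltnW.
Qed.

(** * Signs *)

Lemma sign_parity (R : pzRingType) (m n : nat) :
  odd m = odd n -> (-1) ^+ m = (-1) ^+ n :> R.
Proof. by move=> mn; rewrite -signr_odd mn signr_odd. Qed.

Lemma oppr_sign (R : pzRingType) (m : nat) :
  - (-1) ^+ m = (-1) ^+ m.+1 :> R.
Proof. by rewrite exprS mulN1r. Qed.

(** The exponent n(n+1)/2 in rho fails to be additive in n by exactly pq, which produces the sign of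
    the theorem. *)
Lemma bin2_addS (p q : nat) :
  ('C((p + q).+1, 2) = 'C(p.+1, 2) + 'C(q.+1, 2) + p * q)%N.
Proof.
elim: q => [|q IHq]; first by rewrite addn0 muln0 !addn0.
by rewrite addnS binS IHq bin1 (binS q.+1) bin1 mulnS; lia.
Qed.

Section Reversal.
Variables (V : finType) (K : simplicial_complex V) (xi : descending_weight K).
Variable R : comPzRingType.

(** * Reversed simplices, prism simplices and their weights *)

Definition reverse n : osimplex K n -> osimplex K n := reindex (@rev_ord n.+1).

(* <v_0, ..., v_i, v_n, ..., v_i> *)
Definition prism n i : osimplex K n -> osimplex K n.+1 :=
  reindex (fun j : 'I_n.+2 =>
    inord (if (j <= i)%N then nat_of_ord j else (n.+1 + i - j)%N)).

Lemma reverse_face n (i : 'I_n.+2) (s : osimplex K n.+1) :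
  reverse (face i s) = face (rev_ord i) (reverse s).
Proof.
rewrite /reverse /face !reindex_comp; apply: eq_reindex => j /=.
by rewrite /bump; have := ltn_ord i; have := ltn_ord j; lia.
Qed.

(** Surjectivity keeps every vertex, so the spanned simplex is unchanged. *)
Lemma oweight_reindex_surj m n (f : 'I_m.+1 -> 'I_n.+1) (s : osimplex K n) :
  (forall k, exists j, f j = k) -> oweight xi (reindex f s) = oweight xi s.
Proof.
move=> f_surj; congr (xi _); apply/setP=> x; rewrite !inE.
apply/tnthP/tnthP=> [[j ->]|[k ->]].
  by exists (f j); rewrite tnth_mktuple.
by have [j <-] := f_surj k; exists j; rewrite tnth_mktuple.
Qed.

Lemma oweight_reverse n (s : osimplex K n) :
  oweight xi (reverse s) = oweight xi s.
Proof.
by apply: oweight_reindex_surj => k; exists (rev_ord k); apply: rev_ordK.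
Qed.

Lemma oweight_prism n i (s : osimplex K n) : (i <= n)%N ->
  oweight xi (prism i s) = oweight xi s.
Proof.
move=> lein; apply: oweight_reindex_surj => k; have ltkn := ltn_ord k.
(* A position at which the prism simplex shows the k-th vertex. *)
pose m := if (k <= i)%N then nat_of_ord k else (n.+1 + i - k)%N.
have ltm : (m < n.+2)%N by rewrite /m; case: ifP; lia.
exists (Ordinal ltm); apply: val_inj; rewrite /= inordK /m;
  case: (leqP k i) => leki; rewrite ?leki //; case: ifP; lia.
Qed.

(** * Pullback along rho and the prism operator on cochains *)

Definition pullback n (phi : cochain K R n) : cochain K R n :=
  (extend (fun s : osimplex K n =>
    (-1) ^+ 'C(n.+1, 2) * phi << reverse s >>) : Hom (chain K n) R).

Lemma pullbackE n (phi : cochain K R n) s :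
  pullback phi << s >> = (-1) ^+ 'C(n.+1, 2) * phi << reverse s >>.
Proof. by rewrite /pullback /= extendU mulr1z. Qed.

(** As in [pullback], the binomial exponent counts the inversions of a reversal, here of the tail
    v_n, ..., v_i; the extra i is the usual prism sign. *)
Definition prism_op n (phi : cochain K R n.+1) : cochain K R n :=
  (extend (fun s : osimplex K n =>
    \sum_(0 <= i < n.+1) (-1) ^+ (i + 'C(n.+1 - i, 2)) * phi << prism i s >>)
    : Hom (chain K n) R).

Lemma prism_opE n (phi : cochain K R n.+1) s : prism_op phi << s >> =
  \sum_(0 <= i < n.+1) (-1) ^+ (i + 'C(n.+1 - i, 2)) * phi << prism i s >>.
Proof. by rewrite /prism_op /= extendU mulr1z. Qed.

(** Dropping entry i of the reversal amounts to reversing after dropping entry n+1-i. The signs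
    agree because C(n+2,2) - C(n+1,2) = n+1. *)
Lemma coboundary_pullback n (phi : cochain K R n) :
  coboundary xi (pullback phi) = pullback (coboundary xi phi).
Proof.
apply: cochainP => s; rewrite pullbackE !coboundaryE mulr_sumr.
rewrite (reindex_inj rev_ord_inj) /=; apply: eq_bigr => i _.
rewrite pullbackE reverse_face rev_ordK oweight_reverse.
have <- : oweight xi (reverse (face (rev_ord i) s)) =
  oweight xi (face i (reverse s)) by rewrite reverse_face rev_ordK.
rewrite oweight_reverse -!mulrA [X in _ * X = _]mulrCA [LHS]mulrA [RHS]mulrA.
congr (_ * _); rewrite -!exprD [in RHS]binS bin1.
have lein : (i <= n.+1)%N by have := ltn_ord i.
rewrite subSS -[LHS]signr_odd -[RHS]signr_odd; congr (_ ^+ nat_of_bool _).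
by rewrite !oddD oddB // addbC addbA.
Qed.

(** * Faces of prism simplices *)

Lemma reindex_id n (s : osimplex K n) : reindex id s = s.
Proof. by apply/val_inj/eq_from_tnth=> j; rewrite tnth_mktuple. Qed.

Lemma face_prism_le n i k (s : osimplex K n.+1) : (k <= i)%N -> (i <= n)%N ->
  face (inord k) (prism i.+1 s) = prism i (face (inord k) s).
Proof.
move=> leki lein; rewrite /face /prism !reindex_comp; apply: eq_reindex => j /=.
have ltj := ltn_ord j.
by rewrite /bump !inordK; do ?case: ifP; lia.
Qed.

(** Position k > i lies in the reversed tail and holds v_(n+2+i-k). *)
Lemma face_prism_gt n i k (s : osimplex K n.+1) : (i < k)%N -> (k <= n.+1)%N ->
  face (inord k) (prism i s) = prism i (face (inord (n.+2 + i - k)) s).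
Proof.
move=> ltik lekn; rewrite /face /prism !reindex_comp; apply: eq_reindex => j /=.
have ltj := ltn_ord j.
by rewrite /bump !inordK; do ?case: ifP; lia.
Qed.

(* <v_0, ..., v_(i-1), v_n, ..., v_i> *)
Definition flip n i : osimplex K n -> osimplex K n :=
  reindex (fun j : 'I_n.+1 =>
    inord (if (j < i)%N then nat_of_ord j else (n + i - j)%N)).

Lemma flip0 n (s : osimplex K n) : flip 0 s = reverse s.
Proof.
apply: eq_reindex => j /=; rewrite addn0 subSS inordK //.
by rewrite ltnS leq_subr.
Qed.

Lemma flipS n (s : osimplex K n) : flip n.+1 s = s.
Proof.
rewrite -[RHS]reindex_id; apply: eq_reindex => j /=.
by rewrite ltn_ord inordK.
Qed.

(** Together with [face_prism_last]: [flip i] is both face i of the i-th prism simplex and the last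
    face of the preceding one. Only the ends survive, the reversal [flip0] and the identity
    [flipS]. *)
Lemma face_prism_diag n i (s : osimplex K n) : (i <= n)%N ->
  face (inord i) (prism i s) = flip i s.
Proof.
move=> lein; rewrite /face /prism !reindex_comp; apply: eq_reindex => j /=.
have ltj := ltn_ord j.
by rewrite /bump !inordK; do ?case: ifP; lia.
Qed.

Lemma face_prism_last n i (s : osimplex K n) : (i <= n)%N ->
  face (inord n.+1) (prism i s) = flip i.+1 s.
Proof.
move=> lein; rewrite /face /prism !reindex_comp; apply: eq_reindex => j /=.
have ltj := ltn_ord j.
by rewrite /bump !inordK; do ?case: ifP; lia.
Qed.

(** * Reversal on cohomology and on cup products *)

Lemma is_coboundary_pullback n (phi : cochain K R n) :
  coboundary xi phi = 0 -> is_coboundary xi (pullback phi - phi).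
Proof.
case: n phi => [|n] phi dphi /=.
  (* In degree 0 the map rho is the identity, with sign exponent C(1,2) = 0. *)
  apply: cochainP => s; rewrite -[LHS]/(pullback phi << s >> - phi << s >>).
  rewrite pullbackE mul1r; suff -> : reverse s = s by apply: subrr.
  by apply/val_inj/eq_from_tnth=> j; rewrite tnth_mktuple !ord1.
(* The other term of the homotopy formula is the prism operator applied to the coboundary of [phi],
   which vanishes on a cocycle. *)
exists (prism_op phi); apply: cochainP => s.
rewrite -[LHS]/(pullback phi << s >> - phi << s >>) pullbackE coboundaryE.
(* The weight quotients of iterated faces compose, so that in terms of [Phi] all
   coefficients are signs. *)
pose Phi (t : osimplex K n.+1) : R :=
  (oweight xi t %/ oweight xi s)%N%:R * phi << t >>.
have PhiE t : oweight xi t = oweight xi s -> Phi t = phi << t >>.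
  by rewrite /Phi => ->; rewrite divnn oweight_gt0 mul1r.
pose A i j : R := (-1) ^+ j * ((-1) ^+ (i + 'C(n.+1 - i, 2)) *
  Phi (prism i (face (inord j) s))).
pose B i k : R := (-1) ^+ (i + 'C(n.+2 - i, 2)) *
  ((-1) ^+ k * Phi (face (inord k) (prism i s))).
pose Y i : R := (-1) ^+ 'C(n.+2 - i, 2) * Phi (flip i s).
(* As [prism i s] has the weight of [s], each inner sum is, up to sign, the coboundary of [phi] at
   [prism i s]. *)
have B0 : \sum_(0 <= i < n.+2) \sum_(0 <= k < n.+3) B i k = 0.
  rewrite big_nat big1 // => i /andP[_ ltin].
  have : coboundary xi phi << prism i s >> = 0 by rewrite dphi.
  rewrite coboundaryE -mulr_sumr big_mkord => dphi_is.
  rewrite -[RHS](mulr0 ((-1) ^+ (i + 'C(n.+2 - i, 2)))) -[in RHS]dphi_is.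
  congr (_ * _); apply: eq_bigr => k _.
  by rewrite inord_val /Phi mulrA oweight_prism.
have AY : 0 = Y 0%N - Y n.+2 - \sum_(0 <= i < n.+1) \sum_(0 <= j < n.+2) A i j.
  rewrite -[LHS]B0; apply: prism_sum => [i k leki ltin|i k ltik lekn|i lein];
    rewrite /A /B /Y.
  - rewrite face_prism_le // subSS addSn exprS mulN1r mulNr; congr (- _).
    by rewrite mulrCA.
  - rewrite face_prism_gt // addSnnS -mulNr [LHS]mulrA [RHS]mulrA.
    have lein : (i <= n.+1)%N by apply: ltnW (leq_trans ltik lekn).
    congr (_ * _); rewrite oppr_sign -!exprD (subSn lein).
    by apply: sign_parity; rewrite binS bin1; lia.
  - rewrite face_prism_diag // face_prism_last //.
    rewrite subSS (subSn lein) binS bin1; move: (Phi _) (Phi _) => y x.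
    rewrite -mulNr [X in X + _]mulrA [X in _ + X]mulrA.
    congr (_ * x + _ * y); rewrite ?oppr_sign -!exprD.
      by apply: sign_parity; lia.
    by apply: sign_parity; lia.
have -> : (-1) ^+ 'C(n.+2, 2) * phi << reverse s >> - phi << s >> =
    Y 0%N - Y n.+2.
  by rewrite /Y subn0 subnn mul1r flip0 flipS !PhiE // oweight_reverse.
move/eqP: AY; rewrite eq_sym subr_eq0 => /eqP ->.
(* Summing over the faces j first yields the coboundary of [prism_op phi]: a prism over a face
   weighs as much as the face, so the quotient in [Phi] is the boundary coefficient. *)
rewrite exchange_big_nat big_mkord; apply: eq_bigr => j _.
rewrite prism_opE mulr_sumr big_nat [RHS]big_nat.
apply: eq_bigr => i /andP[_ ltin].
rewrite /A /Phi inord_val oweight_prism // -!mulrA; congr (_ * _).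
by rewrite mulrCA.
Qed.

(** Reversal exchanges front and back faces, the factors commute in [R], and [bin2_addS] accounts
    for the sign. *)
Lemma pullback_cup p q (phi : cochain K R p) (psi : cochain K R q) :
  pullback (cup xi (erefl (p + q)%N) phi psi) =
  cup xi (addnC q p) (pullback psi) (pullback phi) *~ (-1) ^+ (p * q).
Proof.
apply: cochainP => s; rewrite Hom_evalMz pullbackE !cupE !pullbackE.
have front_rev : front p (reverse s) = reverse (back q p s).
  rewrite /front /back /reverse !reindex_comp; apply: eq_reindex => j /=.
  by have ltj := ltn_ord j; rewrite !inordK; lia.
have back_rev : back p q (reverse s) = reverse (front q s).
  rewrite /front /back /reverse !reindex_comp; apply: eq_reindex => j /=.
  by have ltj := ltn_ord j; rewrite !inordK; lia.
rewrite front_rev back_rev !oweight_reverse (mulnC (oweight _ (back _ _ _))).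
rewrite -mulrzl rmorphXn rmorphN1 bin2_addS.
rewrite (exprD _ (_ + _)) (exprD _ 'C(p.+1, 2)) -mulrA [LHS]mulrCA -mulrA.
congr (_ * _); move: (_ ^+ _) (_ ^+ _) => a b.
by rewrite mulrA (mulrC b) [in RHS]mulrACA [RHS]mulrCA (mulrC (psi _)).
Qed.

(** * Commutativity up to coboundaries *)

Lemma is_coboundaryMz n (phi : cochain K R n) (z : int) :
  is_coboundary xi phi -> is_coboundary xi (phi *~ z).
Proof.
case: n phi => [|n] phi /= => [->|[psi ->]]; first exact: mul0rz.
by exists (psi *~ z); rewrite raddfMz.
Qed.

Lemma is_coboundary_subC n (phi psi : cochain K R n) :
  is_coboundary xi (phi - psi) -> is_coboundary xi (psi - phi).
Proof. by move/(is_coboundaryMz (-1)); rewrite mulrN1z opprB. Qed.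

Fact pullback_cocycle_proof n (phi : cocycle xi R n) :
  pullback phi \in @cocycles _ _ xi R n.
Proof.
have /eqP dphi := cocycleP phi; rewrite inE coboundary_pullback dphi.
by apply/eqP/cochainP => s; rewrite pullbackE mulr0.
Qed.

Fact cohomology_class_is_zmod_morphism n :
  zmod_morphism (@cohomology_class _ _ xi R n).
Proof. by move=> f g; rewrite /cohomology_class !piE. Qed.

HB.instance Definition _ n :=
  GRing.isZmodMorphism.Build (cocycle xi R n) (cohomology xi R n)
    (@cohomology_class _ _ xi R n) (@cohomology_class_is_zmod_morphism n).

Lemma cup_commutative p q (phi : cocycle xi R p) (psi : cocycle xi R q) :
  is_coboundary xi (cup xi (erefl (p + q)%N) phi psi -
    cup xi (addnC q p) psi phi *~ (-1) ^+ (p * q)).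
Proof.
have Bpull n (f : cocycle xi R n) :
    is_coboundary xi (pullback f - (f : cochain K R n)).
  by apply: is_coboundary_pullback; apply/eqP; apply: (cocycleP f).
pose pphi := Cocycle (pullback_cocycle_proof phi).
have swap : is_coboundary xi
    (cup xi (addnC q p) (pullback psi) pphi - cup xi (addnC q p) psi phi).
  (* One factor changes at a time, through the product of [psi] and [pphi]; the factor held fixed is
     a cocycle in each step. *)
  rewrite -(subrKA (cup xi (addnC q p) psi pphi)) -[X in _ + X]opprB.
  apply: is_coboundaryB; rewrite -?cupBl -?cupBr.
    exact/is_coboundary_cupl/Bpull.
  exact/is_coboundary_cupr/is_coboundary_subC/Bpull.
(* Passing through the pullback of the product leaves a signed copy of [swap] and an instance of
   [Bpull] for the cocycle [cup_cocycle]. *)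
rewrite -(subrKA (pullback (cup xi (erefl (p + q)%N) phi psi))).
rewrite -[X in X + _]opprB addrC {1}pullback_cup -mulrzBl.
apply: is_coboundaryB; first exact: is_coboundaryMz.
exact: Bpull (cup_cocycle _ _ _).
Qed.

End Reversal.

Theorem theorem9p15 (V : finType) (K : simplicial_complex V)
    (xi : descending_weight K) (xi_div : divisible xi) (R : comPzRingType)
    (p q : nat) (x : cohomology xi R p) (y : cohomology xi R q) :
  cup_class (erefl (p + q)%N) x y =
  cup_class (addnC q p) y x *~ (-1) ^+ (p * q).
Proof.
(* Both products are formed from the same chosen representatives, so the claim concerns two fixed
   cocycles. *)
rewrite /cup_class; set phi := repr x; set psi := repr y.
rewrite -raddfMz; apply/cohomology_classP.
rewrite -[X in is_coboundary _ X]/(val (_ - _ *~ _)) raddfB raddfMz.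
exact: cup_commutative.
Qed.
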